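(* Let $\{(Z_n,\rho_n)\}_{n\ge1}$ be an equicontinuous family of antipodal spaces, and let $(Z,\rho_0)$ be an antipodal space. If $(\mathcal{M}(Z_n,\rho_n),\rho_n)\to(\mathcal{M}(Z,\rho_0),\rho_0)$ in the pointed Gromov-Hausdorff sense, then $(Z_n,\rho_n)\to(Z,\rho_0)$ in the sense of almost-isometric convergence.
   Context: **Semi-metric and antipodal spaces.** A compact semi-metric space $(Z,\rho)$ is a compact metrizable space $Z$ with at least four points together with a separating function, i.e. a continuous symmetric function $\rho:Z\times Z\to[0,\infty)$ with $\rho(\xi,\eta)=0$ iff $\xi=\eta$. It is an antipodal space ($\rho$ is an antipodal function) if moreover $\sup_{\xi,\eta}\rho(\xi,\eta)=1$ and for every $\xi\in Z$ there is $\eta\in Z$ with $\rho(\xi,\eta)=1$. The cross-ratio is $[\xi,\xi',\eta,\eta']_\rho=\frac{\rho(\xi,\eta)\rho(\xi',\eta')}{\rho(\xi,\eta')\rho(\xi',\eta)}$ for distinct points. Two separating functions on $Z$ are Moebius equivalent if they have the same cross-ratios. **Moebius space.** If $\rho_1,\rho_2$ are Moebius equivalent separating functions on $Z$, there is a unique positive continuous function $\frac{d\rho_2}{d\rho_1}$ on $Z$ with $\rho_2(\xi,\eta)^2=\frac{d\rho_2}{d\rho_1}(\xi)\frac{d\rho_2}{d\rho_1}(\eta)\rho_1(\xi,\eta)^2$ for all $\xi,\eta$. For an antipodal space $(Z,\rho_0)$, $\mathcal{M}(Z,\rho_0)$ is the set of all antipodal functions on $Z$ Moebius equivalent to $\rho_0$,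 with metric $d(\rho_1,\rho_2)=\|\log\frac{d\rho_2}{d\rho_1}\|_\infty$. It is a proper geodesic metric space. **Equicontinuity.** A family $\{(Z_\lambda,\rho_\lambda)\}_{\lambda\in\Lambda}$ of compact semi-metric spaces is equicontinuous if for every $\epsilon>0$ there is $\delta>0$ such that for all $\lambda\in\Lambda$ and all $\xi,\eta\in Z_\lambda$ with $\rho_\lambda(\xi,\eta)<\delta$ we have $\sup_{\zeta\in Z_\lambda}|\rho_\lambda(\xi,\zeta)-\rho_\lambda(\eta,\zeta)|<\epsilon$. **Almost-isometric (AI) convergence.** For $\epsilon>0$, an $\epsilon$-isometry $f:(Z_1,\rho_1)\to(Z_2,\rho_2)$ between compact semi-metric spaces is a (not necessarily continuous) map with $\sup_{\xi,\eta\in Z_1}|\rho_2(f(\xi),f(\eta))-\rho_1(\xi,\eta)|<\epsilon$ and such that every point $\eta\in Z_2$ satisfies $\rho_2(f(\zeta),\eta)<\epsilon$ for some $\zeta\in Z_1$. Let $d_{AI}((Z_1,\rho_1),(Z_2,\rho_2))$ be the infimum of $\epsilon>0$ for which there are $\epsilon$-isometries $Z_1\to Z_2$ and $Z_2\to Z_1$. AI-convergence $(Z_n,\rho_n)\to(Z,\rho_0)$ means $d_{AI}((Z_n,\rho_n),(Z,\rho_0))\to0$. **Pointed Gromov-Hausdorff convergence.** A map $f:X\to Y$ of metric spaces (not necessarily continuous) is an $\epsilon$-isometry if $\sup_{x_1,x_2}|d_Y(f(x_1),f(x_2))-d_X(x_1,x_2)|<\epsilon$ and $Y=\bigcup_{x\in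 X}B_Y(f(x),\epsilon)$. For pointed proper geodesic metric spaces, $(X_n,p_n)\to(X,p)$ means: for every $R>0$ and $\epsilon>0$ there is $n_0$ such that for all $n\ge n_0$ there is an $\epsilon$-isometry $f:B_{X_n}(p_n,R)\to B_X(p,R)$ with $f(p_n)=p$. Balls $B_X(p,R)$ are closed. *)

(* Defs.v *)
From mathcomp Require Export all_boot all_order all_algebra.
From mathcomp Require Export all_classical all_reals all_analysis.
Export Order.TTheory GRing.Theory Num.Theory.
Export numFieldNormedType.Exports.

#[export] Set Implicit Arguments.
#[export] Unset Strict Implicit.
#[export] Unset Printing Implicit Defensive.

Local Open Scope classical_set_scope.
Local Open Scope ring_scope.

(* Suprema and infima that enter a condition are taken in \bar R, because
   [sup] in R is 0 by convention on unbounded sets. *)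

Definition metrizable (R : realType) (Z : topologicalType) : Prop :=
  exists d : Z -> Z -> R,
    [/\ forall x y, 0 <= d x y,
        forall x y, d x y = 0 <-> x = y,
        forall x y, d x y = d y x,
        forall x y z, d x z <= d x y + d y z &
        forall (x : Z) (A : set Z),
          nbhs x A <-> exists2 e : R, 0 < e & [set y | d x y < e] `<=` A].

Record separating_function (R : realType) (Z : topologicalType)
    (rho : Z -> Z -> R) : Prop := SeparatingFunction {
  separating_continuous : continuous (fun z : Z * Z => rho z.1 z.2) ;
  separating_sym : forall x y, rho x y = rho y x ;
  separating_ge0 : forall x y, 0 <= rho x y ;
  separating_eq0 : forall x y, rho x y = 0 <-> x = y
}.

Record compact_semimetric_space (R : realType) (Z : topologicalType)
    (rho : Z -> Z -> R) : Prop := CompactSemimetricSpace {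
  semimetric_compact : compact [set: Z] ;
  semimetric_metrizable : metrizable R Z ;
  semimetric_four_points : exists x1 x2 x3 x4 : Z, uniq [:: x1; x2; x3; x4] ;
  semimetric_separating : separating_function rho
}.

Record antipodal_space (R : realType) (Z : topologicalType)
    (rho : Z -> Z -> R) : Prop := AntipodalSpace {
  antipodal_semimetric : compact_semimetric_space rho ;
  antipodal_diam :
    ereal_sup (range (fun z : Z * Z => (rho z.1 z.2)%:E)) = 1%:E ;
  antipodal_ex : forall x, exists y, rho x y = 1
}.

Definition cross_ratio (R : realType) (Z : Type) (rho : Z -> Z -> R)
    (x x' y y' : Z) : R :=
  (rho x y * rho x' y') / (rho x y' * rho x' y).

Definition moebius_equivalent (R : realType) (Z : topologicalType)
    (rho1 rho2 : Z -> Z -> R) : Prop :=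
  forall x x' y y' : Z, uniq [:: x; x'; y; y'] ->
    cross_ratio rho1 x x' y y' = cross_ratio rho2 x x' y y'.

Definition is_moebius_derivative (R : realType) (Z : topologicalType)
    (rho1 rho2 : Z -> Z -> R) (f : Z -> R) : Prop :=
  [/\ continuous f,
      forall x, 0 < f x &
      forall x y, rho2 x y ^+ 2 = f x * f y * rho1 x y ^+ 2].

(* d rho2 / d rho1; the default value 1 is irrelevant when rho1 and rho2 are
   Moebius equivalent separating functions on a space with at least four
   points, since the derivative then exists and is unique. *)
Definition moebius_derivative (R : realType) (Z : topologicalType)
    (rho1 rho2 : Z -> Z -> R) : Z -> R :=
  xget (fun=> 1) [set f : Z -> R | is_moebius_derivative rho1 rho2 f].

Definition moebius_space (R : realType) (Z : topologicalType)
    (rho0 : Z -> Z -> R) : set (Z -> Z -> R) :=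
  [set rho | antipodal_space rho /\ moebius_equivalent rho rho0].

(* The supremum is that of a bounded set for compact Z, as the derivative is
   continuous and positive. *)
Definition moebius_dist (R : realType) (Z : topologicalType)
    (rho1 rho2 : Z -> Z -> R) : R :=
  sup (range (fun x : Z => `|ln (moebius_derivative rho1 rho2 x)|)).

Definition equicontinuous_spaces (R : realType) (L : Type)
    (Z : L -> topologicalType) (rho : forall l, Z l -> Z l -> R) : Prop :=
  forall e : R, 0 < e -> exists2 delta : R, 0 < delta &
    forall (l : L) (x y : Z l), rho l x y < delta ->
      (ereal_sup (range (fun z : Z l => `|rho l x z - rho l y z|%:E)) < e%:E)%E.

Definition semimetric_isometry (R : realType) (Z1 Z2 : Type)
    (rho1 : Z1 -> Z1 -> R) (rho2 : Z2 -> Z2 -> R) (e : R) (f : Z1 -> Z2) : Prop :=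
  (ereal_sup (range (fun z : Z1 * Z1 =>
     `|rho2 (f z.1) (f z.2) - rho1 z.1 z.2|%:E)) < e%:E)%E /\
  forall y : Z2, exists x : Z1, rho2 (f x) y < e.

Definition AI_dist (R : realType) (Z1 Z2 : Type)
    (rho1 : Z1 -> Z1 -> R) (rho2 : Z2 -> Z2 -> R) : \bar R :=
  ereal_inf [set e%:E | e in [set e : R |
    [/\ 0 < e,
        exists f : Z1 -> Z2, semimetric_isometry rho1 rho2 e f &
        exists g : Z2 -> Z1, semimetric_isometry rho2 rho1 e g]]].

Definition AI_converges (R : realType) (Z : nat -> Type)
    (rho : forall n, Z n -> Z n -> R) (Z0 : Type) (rho0 : Z0 -> Z0 -> R) : Prop :=
  (fun n => AI_dist (rho n) rho0) @ \oo --> 0%:E.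

(* Below, a metric space is given by a set of points [A : set X] together with a
   distance [d : X -> X -> R], of which only the restriction to [A] is used. *)
Definition metric_cball (R : realType) (X : Type) (A : set X)
    (d : X -> X -> R) (p : X) (r : R) : set X :=
  [set x | A x /\ d p x <= r].

(* Only the restriction of [f] to [A] matters, so that [f] stands for a map
   from [A] to [B]. *)
Definition metric_isometry (R : realType) (X Y : Type)
    (A : set X) (dX : X -> X -> R) (B : set Y) (dY : Y -> Y -> R)
    (e : R) (f : X -> Y) : Prop :=
  [/\ forall x, A x -> B (f x),
      (ereal_sup [set `|dY (f x.1) (f x.2) - dX x.1 x.2|%:E | x in A `*` A]
        < e%:E)%E &
      B = \bigcup_(x in A) metric_cball B dY (f x) e].

Definition pointed_GH_converges (R : realType)
    (X : nat -> Type) (A : forall n, set (X n))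
    (d : forall n, X n -> X n -> R) (p : forall n, X n)
    (X0 : Type) (A0 : set X0) (d0 : X0 -> X0 -> R) (p0 : X0) : Prop :=
  forall r e : R, 0 < r -> 0 < e -> exists n0 : nat,
    forall n : nat, (n0 <= n)%N ->
      exists f : X n -> X0,
        metric_isometry (metric_cball (A n) (d n) (p n) r) (d n)
                        (metric_cball A0 d0 p0 r) d0 e f /\
        f (p n) = p0.

(* Main.v *)
Require Import Defs.
From mathcomp Require Import ring lra.

Local Open Scope classical_set_scope.
Local Open Scope ring_scope.

(** Fix an antipodal space [(Z, rho0)]. Every [rho] in its Moebius space can be
    written [rho x y = exp (psi x + psi y) * rho0 x y] for one continuous
    function [psi], its potential, and the Moebius distance is twice the
    uniform distance between potentials ([potentialE],
    [moebius_dist_attained]). Since [rho] is antipodal, [psi] attains the value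
    [d rho0 rho / 2] at some point, a peak of [rho] ([potential_peak]);
    conversely, every point of [Z] is a peak of metrics at any prescribed
    distance from [rho0] ([moebius_space_ray]). Thus the points of [Z] are the
    directions of the Moebius space seen from [rho0].

    The function [rho0] on [Z] is read off from distances in the Moebius space
    through the Gromov product [G] based at [rho0]. If [rho1] and [rho2] have
    peaks [x] and [y], then [rho0 x y <= exp (- G rho1 rho2)]. In the other
    direction, a point where the two potentials differ most, together with one
    of its antipodes, gives [z] and [z'] with
    [exp (- G rho1 rho2) <= rho0 z z']; when [rho1] and [rho2] are far from
    [rho0] and [G rho1 rho2] is bounded, [z] is close to [x] and [z'] to [y]. A
    modulus of equicontinuity then turns this into
    [rho0 x y <= exp (- G rho1 rho2) <= rho0 x y + 2 * e], with [e] depending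
    only on the modulus and on the distances to [rho0]
    ([gromov_product_estimate]). When [G rho1 rho2] is large there is nothing
    to prove, as [exp (- G rho1 rho2) <= e].

    Now let [F] be an almost isometry between large balls of the Moebius spaces
    of [rhon n] and [rho0] which maps centre to centre. It almost preserves
    Gromov products. Relate a point of [Zn n] to a point of [Z] when they are
    peaks of metrics [p] and [q], both far from the base points, with [F p]
    close to [q]. By the existence of peaks and of metrics with a prescribed
    peak, and since [F] is almost onto, this relation is total on both sides;
    by the estimate above, its distortion is small
    ([peak_correspondence_distortion]). Choosing related points yields almost
    isometries in both directions. The argument is uniform in [n], because a
    single modulus serves the whole family. *)

(** * Moebius derivatives *)

Section Derivative.
Variables (R : realType) (Z : topologicalType).
Implicit Types rho : Z -> Z -> R.

Lemma separating_gt0 rho x y : separating_function rho -> x != y -> 0 < rho x y.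
Proof.
move=> s xy; rewrite lt_neqAle (separating_ge0 s) andbT eq_sym.
by apply: contra xy => /eqP/(separating_eq0 s) ->.
Qed.

Lemma separating_diag rho x : separating_function rho -> rho x x = 0.
Proof. by move=> s; apply/(separating_eq0 s). Qed.

Lemma cvg_separating rho (T : Type) (F : set_system T) (f g : T -> Z)
    (a b : Z) :
  separating_function rho -> Filter F -> f @ F --> a -> g @ F --> b ->
  rho (f x) (g x) @[x --> F] --> rho a b.
Proof.
move=> s FF fa gb; apply: (@continuous2_cvg _ _ _ _ _ _ _ _ rho) fa gb.
exact: (@separating_continuous _ _ _ s (a, b)).
Qed.

Lemma separating_continuousl rho y :
  separating_function rho -> continuous (fun x => rho x y).
Proof. by move=> s x; apply: cvg_separating => //; exact: cvg_cst. Qed.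

Lemma exists_other_point rho (x y : Z) : compact_semimetric_space rho ->
  exists z, (z != x) && (z != y).
Proof.
case=> _ _ [a [b [c [d]]]] /=; rewrite !inE !negb_or -!andbA.
case/and4P=> ab ac _ /andP[bc _] _.
have [<-|ax] := eqVneq a x.
  have [<-|bY] := eqVneq b y; last by exists b; rewrite eq_sym ab bY.
  by exists c; rewrite eq_sym ac eq_sym bc.
have [<-|ay] := eqVneq a y; last by exists a; rewrite ax ay.
have [<-|bx] := eqVneq b x; last by exists b; rewrite bx eq_sym ab.
by exists c; rewrite eq_sym bc eq_sym ac.
Qed.

(** The quotient [g] of two derivatives satisfies [g x * g y = 1] for all
    distinct [x] and [y]; on three points this forces [g = 1]. *)
Lemma moebius_derivative_unique rho1 rho2 f g : compact_semimetric_space rho1 ->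
  is_moebius_derivative rho1 rho2 f -> is_moebius_derivative rho1 rho2 g ->
  f = g.
Proof.
move=> c1 [_ f0 fE] [_ g0 gE]; have s1 := semimetric_separating c1.
have H x y : x != y -> f x * f y = g x * g y.
  move=> xy; have := fE x y; rewrite gE => /mulIf -> //.
  by rewrite sqrf_eq0 gt_eqF// separating_gt0.
apply/funext => x.
have [y /andP[yx _]] := exists_other_point x x c1.
have [z /andP[zx zy]] := exists_other_point x y c1.
have := H _ _ yx; have := H _ _ zx; have := H _ _ zy.
move: (f0 x) (f0 y) (f0 z) (g0 x) (g0 y) (g0 z) => *.
have E2 : f x ^+ 2 = g x ^+ 2.
  apply: (@mulIf _ (f z * f y)); first by rewrite mulf_neq0// gt_eqF.
  have -> : f x ^+ 2 * (f z * f y) = (f z * f x) * (f y * f x) by ring.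
  by rewrite H// H// (H z y)//; ring.
by apply/eqP; rewrite -(@eqrXn2 _ 2)// ?E2 ?ltW.
Qed.

Let ratio rho1 rho2 x y : R := rho2 x y / rho1 x y.

(** If [rho2 x y ^+ 2 = f x * f y * rho1 x y ^+ 2] for all [x] and [y], then
    [f x = triple rho1 rho2 x y z] whenever [x], [y], [z] are distinct. *)
Let triple rho1 rho2 x y z : R :=
  ratio rho1 rho2 x y * ratio rho1 rho2 x z / ratio rho1 rho2 y z.

(** Equality of the cross-ratios of the four points [x], [y], [z], [z'] says
    exactly that [z] may be replaced by [z']. *)
Lemma triple_change rho1 rho2 x y z z' :
  separating_function rho1 -> separating_function rho2 ->
  moebius_equivalent rho1 rho2 ->
  x != y -> x != z -> y != z -> x != z' -> y != z' ->
  triple rho1 rho2 x y z = triple rho1 rho2 x y z'.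
Proof.
move=> s1 s2 eqv xy xz yz xz' yz'.
have [<-//|zz'] := eqVneq z z'.
have := eqv x y z z'; rewrite /= !inE !negb_or xy xz yz xz' yz' zz'.
move=> /(_ isT); rewrite /cross_ratio /triple /ratio.
have P1 := fun a b => separating_gt0 s1 (x:=a) (y:=b).
have P2 := fun a b => separating_gt0 s2 (x:=a) (y:=b).
move: (P1 _ _ xy) (P1 _ _ xz) (P1 _ _ yz) (P1 _ _ xz') (P1 _ _ yz').
move: (P2 _ _ xy) (P2 _ _ xz) (P2 _ _ yz) (P2 _ _ xz') (P2 _ _ yz').
do 10!move=> /lt0r_neq0 ?.
move=> E.
have E' : rho1 x z * rho1 y z' * (rho2 x z' * rho2 y z) =
   rho2 x z * rho2 y z' * (rho1 x z' * rho1 y z).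
  by apply/eqP; rewrite -eqr_div ?mulf_neq0//; apply/eqP.
apply/eqP; rewrite -subr_eq0; apply/eqP.
transitivity (rho2 x y / rho1 x y *
  (rho2 x z * rho2 y z' * (rho1 x z' * rho1 y z)
   - rho1 x z * rho1 y z' * (rho2 x z' * rho2 y z))
  / (rho1 x z * rho1 x z' * rho2 y z * rho2 y z')).
  by field; do ?[apply/andP; split].
by rewrite E' subrr mulr0 mul0r.
Qed.

(** The derivative at [x] is [triple rho1 rho2 x y z] for any auxiliary [y] and
    [z]. With [y] and [z] kept fixed, this expression is continuous near [x];
    the functional equation at [x] and [y] follows by using the same third
    point for both. *)
Lemma moebius_derivative_exists rho1 rho2 :
  compact_semimetric_space rho1 -> compact_semimetric_space rho2 ->
  moebius_equivalent rho1 rho2 -> exists f, is_moebius_derivative rho1 rho2 f.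
Proof.
move=> c1 c2 eqv.
have s1 := semimetric_separating c1; have s2 := semimetric_separating c2.
have r0 x y : x != y -> 0 < ratio rho1 rho2 x y.
  by move=> xy; rewrite divr_gt0// separating_gt0.
have rC x y : ratio rho1 rho2 x y = ratio rho1 rho2 y x.
  by rewrite /ratio (separating_sym s1) (separating_sym s2).
have tC x y z : triple rho1 rho2 x y z = triple rho1 rho2 x z y.
  by rewrite /triple (rC y) [ratio _ _ x z * _]mulrC.
have [f fE] : {f : Z -> R & forall x y z, x != y -> x != z -> y != z ->
    f x = triple rho1 rho2 x y z}.
  apply: (@choice _ _ (fun x c => forall y z, x != y -> x != z -> y != z ->
    c = triple rho1 rho2 x y z)) => x.
  (* Two pairs of auxiliary points are joined by changing one point at a
     time. *)
  have [y0 /andP[y0x _]] := exists_other_point x x c1.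
  have [z0 /andP[z0x zy0]] := exists_other_point x y0 c1.
  exists (triple rho1 rho2 x y0 z0) => y z xy xz yz.
  rewrite eq_sym in y0x; rewrite eq_sym in z0x; rewrite eq_sym in zy0.
  have T := triple_change s1 s2 eqv.
  have [?|yy0] := eqVneq y0 y.
    by subst y; exact: T.
  have [?|zy] := eqVneq y0 z.
    by subst z; rewrite (tC x y); apply: T; rewrite // eq_sym.
  rewrite (tC x y z); transitivity (triple rho1 rho2 x z y0).
    by rewrite (tC x z); apply: T.
  by apply: T; rewrite // eq_sym.
exists f; split.
- move=> x.
  have [y /andP[yx _]] := exists_other_point x x c1.
  have [z /andP[zx zy]] := exists_other_point x y c1.
  have near_ne a : a != x -> \forall t \near x, t != a.
    move=> ax; have := @separating_continuousl rho1 a s1 x.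
    have p : 0 < rho1 x a by rewrite separating_gt0// eq_sym.
    move=> /cvgr_gt /(_ _ p).
    apply: filterS => t /=; apply: contraTneq => ->.
    by rewrite separating_diag// ltxx.
  have E : \forall t \near x, triple rho1 rho2 t y z = f t.
    near=> t; apply/esym/fE; last by rewrite eq_sym.
      by near: t; exact: near_ne.
    by near: t; exact: near_ne.
  rewrite /continuous_at (fE x y z); [|by rewrite eq_sym..].
  apply: cvg_trans; first exact: near_eq_cvg E.
  have cr a : a != x -> ratio rho1 rho2 t a @[t --> x] --> ratio rho1 rho2 x a.
    move=> ax; apply: cvgM; first exact: separating_continuousl.
    apply: cvgV; first by rewrite gt_eqF// separating_gt0// eq_sym.
    exact: separating_continuousl.
  by apply: cvgMr_tmp; apply: cvgM; exact: cr.
- move=> x.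
  have [y /andP[yx _]] := exists_other_point x x c1.
  have [z /andP[zx zy]] := exists_other_point x y c1.
  rewrite (fE x y z); [|by rewrite eq_sym..].
  by apply: divr_gt0; [apply: mulr_gt0|]; apply: r0; rewrite eq_sym.
- move=> x y; have [<-|xy] := eqVneq x y.
    by rewrite !separating_diag// expr0n mulr0.
  have [z /andP[zx zy]] := exists_other_point x y c1.
  rewrite eq_sym in zx; rewrite eq_sym in zy.
  rewrite (fE x y z)// (fE y x z)//; last by rewrite eq_sym.
  rewrite /triple (rC y x) -[RHS]mulrA.
  move: (r0 _ _ xy) (r0 _ _ zx) (r0 _ _ zy) (separating_gt0 s1 xy).
  have -> : rho2 x y ^+ 2 = ratio rho1 rho2 x y ^+ 2 * rho1 x y ^+ 2.
    by rewrite -exprMn divfK// gt_eqF// separating_gt0.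
  do 4!move=> /lt0r_neq0 ?; field; do ?[apply/andP; split] => //.
Unshelve. all: by end_near.
Qed.

Lemma moebius_derivativeE rho1 rho2 f : compact_semimetric_space rho1 ->
  is_moebius_derivative rho1 rho2 f -> moebius_derivative rho1 rho2 = f.
Proof.
move=> c1 fP; rewrite /moebius_derivative.
by case: xgetP => [g _ gP|/(_ f)//]; apply: moebius_derivative_unique gP fP.
Qed.

End Derivative.

(** * Potentials and the Moebius distance *)

(** Half of the logarithm, because the derivative relates the squares of the
    separating functions. *)
Definition potential (R : realType) (Z : topologicalType)
    (rho0 rho : Z -> Z -> R) (x : Z) : R :=
  ln (moebius_derivative rho0 rho x) / 2.

Section Potential.
Variables (R : realType) (Z : topologicalType) (rho0 : Z -> Z -> R).
Hypothesis rho0P : antipodal_space rho0.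
Implicit Types rho : Z -> Z -> R.

Local Notation M := (moebius_space rho0).
Local Notation psi := (potential rho0).
Local Notation d := (@moebius_dist R Z).

Lemma antipodal_le1 rho x y : antipodal_space rho -> rho x y <= 1.
Proof.
move=> [_ E _]; rewrite -lee_fin -E; apply: ereal_sup_ubound.
by exists (x, y).
Qed.

Lemma potential_derivative rho : M rho ->
  is_moebius_derivative rho0 rho (fun x => expR (2 * psi rho x)).
Proof.
move=> [[c _ _] e]; have c0 := antipodal_semimetric rho0P.
have [x x' y y' u|f fP] := moebius_derivative_exists c0 c.
  by rewrite e.
have -> // : (fun x => expR (2 * psi rho x)) = f.
apply/funext => x; rewrite /potential (moebius_derivativeE c0 fP).
by rewrite mulrC divfK// lnK// posrE; case: fP.
Qed.

Lemma continuous_potential rho : M rho -> continuous (psi rho).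
Proof.
move=> Mr; have [fc f0 _] := potential_derivative Mr.
have -> : psi rho = (fun x => ln (expR (2 * psi rho x)) / 2).
  by apply/funext => x; rewrite expRK mulrAC divff// mul1r.
move=> x; apply: cvgMr_tmp.
apply: (@continuous_comp _ _ _ (fun x => expR (2 * psi rho x)) (@ln R)).
  exact: fc.
by apply: continuous_ln; exact: f0.
Qed.

Lemma potentialE rho x y : M rho ->
  rho x y = expR (psi rho x + psi rho y) * rho0 x y.
Proof.
move=> Mr; have [_ _ E] := potential_derivative Mr.
have s := semimetric_separating (antipodal_semimetric Mr.1).
have s0 := semimetric_separating (antipodal_semimetric rho0P).
apply/eqP; rewrite -(@eqrXn2 _ 2)// ?(separating_ge0 s)//.
  by rewrite E exprMn -expRD -expRM_natl mulrDr.
by rewrite mulr_ge0 ?expR_ge0// (separating_ge0 s0).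
Qed.

Lemma moebius_derivative_potential rho1 rho2 x : M rho1 -> M rho2 ->
  moebius_derivative rho1 rho2 x = expR (2 * (psi rho2 x - psi rho1 x)).
Proof.
move=> M1 M2.
rewrite (moebius_derivativeE (antipodal_semimetric M1.1)
  (f := fun x => expR (2 * (psi rho2 x - psi rho1 x))))//.
split.
- move=> y; apply: (@continuous_comp _ _ _
    (fun x => 2 * (psi rho2 x - psi rho1 x)) (@expR R)); last first.
    exact: continuous_expR.
  by apply: cvgMl_tmp; apply: cvgB; apply: continuous_potential.
- by move=> y; exact: expR_gt0.
- move=> y z; rewrite (potentialE y z M1) (potentialE y z M2) !exprMn.
  rewrite [RHS]mulrA -!expRM_natl -!expRD.
  by congr (expR _ * _); ring.
Qed.

(** The derivative of [rho2] with respect to [rho1] is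
    [exp (2 * (psi rho2 - psi rho1))], so the supremum in the distance is that
    of a continuous function on a compact space. *)
Lemma moebius_dist_attained rho1 rho2 : M rho1 -> M rho2 ->
  exists2 x, d rho1 rho2 = 2 * `|psi rho2 x - psi rho1 x| &
    forall y, 2 * `|psi rho2 y - psi rho1 y| <= d rho1 rho2.
Proof.
move=> M1 M2.
have dE : d rho1 rho2 = sup (range (fun x => 2 * `|psi rho2 x - psi rho1 x|)).
  rewrite /moebius_dist; congr sup; apply: eq_imagel => x _.
  rewrite moebius_derivative_potential// expRK normrM.
  by rewrite (ger0_norm (ler0n _ 2)).
have [x1 _] := semimetric_four_points (antipodal_semimetric rho0P).
have fcont : continuous (fun x => 2 * `|psi rho2 x - psi rho1 x|).
  move=> x; apply: cvgMl_tmp; apply: cvg_norm; apply: cvgB;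
    exact: continuous_potential.
have [x _ xmax] := compact_EVT_max (ex_intro _ x1 I : [set: Z] !=set0)
  (semimetric_compact (antipodal_semimetric rho0P))
  (continuous_subspaceT fcont).
have xub : ubound (range (fun x => 2 * `|psi rho2 x - psi rho1 x|))
    (2 * `|psi rho2 x - psi rho1 x|).
  by move=> _ [y _ <-]; apply: xmax; rewrite inE.
have E : d rho1 rho2 = 2 * `|psi rho2 x - psi rho1 x|.
  apply/eqP; rewrite dE eq_le ge_sup//=; last first.
    by exists (2 * `|psi rho2 x - psi rho1 x|), x.
  by apply: ub_le_sup; [exists (2 * `|psi rho2 x - psi rho1 x|)|exists x].
by exists x => // y; rewrite E; apply: xub; exists y.
Qed.

Lemma moebius_dist_ge rho1 rho2 x : M rho1 -> M rho2 ->
  2 * `|psi rho2 x - psi rho1 x| <= d rho1 rho2.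
Proof. by move=> M1 M2; have [y _] := moebius_dist_attained M1 M2; apply. Qed.

Lemma moebius_distC rho1 rho2 : M rho1 -> M rho2 -> d rho1 rho2 = d rho2 rho1.
Proof.
have le r1 r2 : M r1 -> M r2 -> d r1 r2 <= d r2 r1.
  move=> M1 M2; have [x -> _] := moebius_dist_attained M1 M2.
  by rewrite distrC moebius_dist_ge.
by move=> M1 M2; apply/eqP; rewrite eq_le !le.
Qed.

Lemma moebius_dist_triangle rho2 rho1 rho3 : M rho1 -> M rho2 -> M rho3 ->
  d rho1 rho3 <= d rho1 rho2 + d rho2 rho3.
Proof.
move=> M1 M2 M3; have [x -> _] := moebius_dist_attained M1 M3.
apply: le_trans (lerD (moebius_dist_ge x M1 M2) (moebius_dist_ge x M2 M3)).
by rewrite -mulrDr ler_pM2l// [leRHS]addrC; exact: ler_distD.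
Qed.

Lemma moebius_space_base : M rho0.
Proof. by split. Qed.

Lemma potential_base x : psi rho0 x = 0.
Proof.
rewrite /potential (moebius_derivativeE (f := fun=> 1) _ _) ?ln1 ?mul0r//.
  exact: antipodal_semimetric rho0P.
by split => [y|//|y z]; [exact: cvg_cst|rewrite !mul1r].
Qed.

Lemma moebius_dist_base rho x : M rho -> 2 * `|psi rho x| <= d rho0 rho.
Proof.
move=> Mr; have := moebius_dist_ge x moebius_space_base Mr.
by rewrite potential_base subr0.
Qed.

Lemma moebius_distxx : d rho0 rho0 = 0.
Proof.
have [x -> _] := moebius_dist_attained moebius_space_base moebius_space_base.
by rewrite subrr normr0 mulr0.
Qed.

(** The distance is the maximum of [2 * `|psi rho|]. If it is attained where
    [psi rho] is negative, then an antipode [y] of that point [x] for [rho]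
    satisfies
    [1 = exp (psi rho x + psi rho y) * rho0 x y <= exp (psi rho x + psi rho y)],
    so that [psi rho y] is as large as [- psi rho x]. *)
Lemma potential_peak rho : M rho -> exists x, 2 * psi rho x = d rho0 rho.
Proof.
move=> Mr; have [x] := moebius_dist_attained moebius_space_base Mr.
rewrite potential_base subr0 => dE dmax.
have [p0|p0] := leP 0 (psi rho x); first by exists x; rewrite dE ger0_norm.
have [y y1] := antipodal_ex Mr.1 x.
exists y; rewrite dE ltr0_norm//; congr (_ * _); apply/eqP; rewrite eq_le.
apply/andP; split.
  have := ler_norm (psi rho y).
  by have := dmax y; rewrite potential_base subr0 dE (ltr0_norm p0); lra.
have := potentialE x y Mr; rewrite y1 => /esym E.
have : 0 <= psi rho x + psi rho y; last by lra.
rewrite -ler_expR expR0 -[leLHS]E ler_piMr ?expR_ge0//.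
exact: antipodal_le1.
Qed.

End Potential.

(** * The Gromov product at the base point *)

Definition modulus (R : realType) (Z : Type) (rho : Z -> Z -> R) (e dl : R) :=
  forall x y, rho x y < dl -> forall z, `|rho x z - rho y z| < e.

Section Gromov.
Variables (R : realType) (Z : topologicalType) (rho0 : Z -> Z -> R).
Hypothesis rho0P : antipodal_space rho0.
Implicit Types rho : Z -> Z -> R.

Local Notation M := (moebius_space rho0).
Local Notation psi := (potential rho0).
Local Notation d := (@moebius_dist R Z).

Definition gromov_product rho rho1 rho2 : R :=
  (d rho rho1 + d rho rho2 - d rho1 rho2) / 2.
Local Notation G := (gromov_product rho0).

Lemma base_le_potential rho x y :
  M rho -> rho0 x y <= expR (- (psi rho x + psi rho y)).
Proof.
move=> Mr; rewrite expRN -[leRHS]mulr1 ler_pdivlMl ?expR_gt0//.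
by rewrite -(potentialE rho0P)//; exact: antipodal_le1 Mr.1.
Qed.

(** At [x], [psi rho2] is at least [psi rho1 x - d rho1 rho2 / 2], and both
    potentials are explicit at their peaks; it remains to use
    [rho2 x y <= 1]. *)
Lemma gromov_product_lower rho1 rho2 x y : M rho1 -> M rho2 ->
  2 * psi rho1 x = d rho0 rho1 -> 2 * psi rho2 y = d rho0 rho2 ->
  rho0 x y <= expR (- G rho1 rho2).
Proof.
move=> M1 M2 px py; apply: le_trans (base_le_potential x y M2) _.
rewrite ler_expR lerN2 /gromov_product -px -py.
have := moebius_dist_ge rho0P x M1 M2.
have := ler_norm (psi rho1 x - psi rho2 x); rewrite distrC; lra.
Qed.

(** At some point the potentials differ by [d rho1 rho2 / 2]. If [psi rho1] is
    the larger one there, then this point is [z], and [z'] is one of its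
    antipodes for [rho2]; otherwise exchange the two metrics. The antipodal
    relation expresses [rho0 z z'] by the potentials, which are at most half
    the distances to the base point. It also forces [psi rho1 z] and
    [psi rho2 z'] to be large, so that [z] and [z'] lie close to the peaks. *)
Lemma gromov_product_upper rho1 rho2 x y : M rho1 -> M rho2 ->
  2 * psi rho1 x = d rho0 rho1 -> 2 * psi rho2 y = d rho0 rho2 ->
  exists z z', [/\ expR (- G rho1 rho2) <= rho0 z z',
    rho0 x z <= expR (G rho1 rho2 - d rho0 rho1) &
    rho0 y z' <= expR (G rho1 rho2 - d rho0 rho2)].
Proof.
move=> M1 M2.
have [w wE _] := moebius_dist_attained rho0P M1 M2.
wlog: rho1 rho2 x y w M1 M2 wE / d rho1 rho2 = 2 * (psi rho1 w - psi rho2 w).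
  move=> H px py; have [w0|w0] := leP 0 (psi rho1 w - psi rho2 w).
    by apply: (H _ _ _ _ w) => //; rewrite wE distrC ger0_norm.
  have := @H rho2 rho1 y x w M2 M1.
  rewrite /gromov_product (moebius_distC rho0P M2 M1) [d rho0 rho2 + _]addrC.
  rewrite distrC.
  case=> // [|z [z' [h1 h2 h3]]].
    by rewrite wE distrC ltr0_norm// opprB.
  exists z', z; split; [|exact: h3|exact: h2].
  have s0 := semimetric_separating (antipodal_semimetric rho0P).
  by rewrite (separating_sym s0).
move=> dE px py.
have [w' w'1] := antipodal_ex M2.1 w.
have E : rho0 w w' = expR (- (psi rho2 w + psi rho2 w')).
  rewrite expRN; apply: (@mulfI _ (expR (psi rho2 w + psi rho2 w'))).
    by rewrite gt_eqF// expR_gt0.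
  by rewrite -(potentialE rho0P)// w'1 divff// gt_eqF// expR_gt0.
have E0 : 0 <= psi rho2 w + psi rho2 w'.
  rewrite -oppr_le0 -expR_le1 -E; exact: antipodal_le1.
have b1 := moebius_dist_base rho0P w M1.
have b2 := moebius_dist_base rho0P w' M2.
have n1 := ler_norm (psi rho1 w); have n2 := ler_norm (psi rho2 w').
exists w, w'; split.
- rewrite E ler_expR /gromov_product; lra.
- apply: le_trans (base_le_potential _ _ M1) _.
  rewrite ler_expR /gromov_product; lra.
- apply: le_trans (base_le_potential _ _ M2) _.
  rewrite ler_expR /gromov_product; lra.
Qed.

(** If [exp (- G) > e], then the points [z] and [z'] above are at distance less
    than [exp (- t) / e < dl] from [x] and [y], and replacing them by [x] and
    [y] changes [rho0] by less than [2 * e]. *)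
Lemma gromov_product_estimate e dl t rho1 rho2 x y : 0 < e -> 0 < dl ->
  modulus rho0 e dl -> expR (- t) < e * dl -> M rho1 -> M rho2 ->
  t <= d rho0 rho1 -> t <= d rho0 rho2 ->
  2 * psi rho1 x = d rho0 rho1 -> 2 * psi rho2 y = d rho0 rho2 ->
  rho0 x y <= expR (- G rho1 rho2) <= rho0 x y + 2 * e.
Proof.
move=> e0 dl0 md te M1 M2 t1 t2 px py.
rewrite gromov_product_lower//=.
have s0 := semimetric_separating (antipodal_semimetric rho0P).
have := separating_ge0 s0 x y.
have [|Ge] := leP (expR (- G rho1 rho2)) e; first by lra.
have [z [z' [zz' xz yz']]] := gromov_product_upper M1 M2 px py.
have small s : t <= s -> expR (G rho1 rho2 - s) < dl.
  move=> ts; rewrite expRD -(ltr_pM2l e0); apply: le_lt_trans te.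
  have : expR (- s) <= expR (- t) by rewrite ler_expR lerN2.
  apply: le_trans; rewrite mulrA -[leRHS]mul1r ler_wpM2r ?expR_ge0//.
  have <- : expR (- G rho1 rho2) * expR (G rho1 rho2) = 1.
    by rewrite -expRD addNr expR0.
  by rewrite ler_wpM2r ?expR_ge0// ltW.
have h1 := md _ _ (le_lt_trans xz (small _ t1)) z'.
have h2 := md _ _ (le_lt_trans yz' (small _ t2)) x.
rewrite !(separating_sym s0 _ x) in h2.
move: h1 h2; rewrite !ltr_distlC => /andP[_ h1] /andP[_ h2].
by clear -h1 h2 zz'; lra.
Qed.

Lemma gromov_product_ge0 rho1 rho2 : M rho1 -> M rho2 -> 0 <= G rho1 rho2.
Proof.
move=> M1 M2; have M0 := moebius_space_base rho0P.
have := moebius_dist_triangle rho0P M1 M0 M2.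
by rewrite (moebius_distC rho0P M1 M0) /gromov_product; lra.
Qed.

End Gromov.

(** * Equicontinuity of a compact space *)

Section Modulus.
Variables (R : realType) (Z : topologicalType) (rho0 : Z -> Z -> R).

(** On the compact set of triples with [e <= `|rho0 x z - rho0 y z|], the
    function [rho0 x y] does not vanish; its minimum there is a modulus. *)
Lemma semimetric_modulus (e : R) : compact_semimetric_space rho0 -> 0 < e ->
  exists2 dl : R, 0 < dl & modulus rho0 e dl.
Proof.
move=> c e0; have s := semimetric_separating c.
pose h (p : Z * Z * Z) := `|rho0 p.1.1 p.2 - rho0 p.1.2 p.2|.
have c11 (p : Z * Z * Z) : p.1.1 @[p --> p] --> p.1.1.
  by apply: (@cvg_comp _ _ _ fst fst _ (nbhs p.1)); exact: cvg_fst.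
have c12 (p : Z * Z * Z) : p.1.2 @[p --> p] --> p.1.2.
  apply: (@cvg_comp _ _ _ fst snd _ (nbhs p.1)).
    exact: cvg_fst.
  exact: cvg_snd.
have hc : continuous h.
  move=> p; apply: cvg_norm; apply: cvgB; apply: cvg_separating => //;
    first [exact: c11 | exact: c12 | exact: cvg_snd].
pose K := [set p | e <= h p].
have Kc : compact K.
  apply: (@subclosed_compact _ _ setT) => //.
    apply: (preimage_closed (f := h) (D := [set x | e <= x]));
      last exact: closed_ge.
    by move=> x _; exact: hc.
  have Zc := semimetric_compact c.
  rewrite -(@setXTT (Z * Z) Z) -(@setXTT Z Z).
  exact: compact_setX (compact_setX Zc Zc) Zc.
have [/set0P K0|/negPn/eqP K0] := boolP (K != set0); last first.
  exists 1 => // x y _ z; rewrite ltNge; apply/negP => ez.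
  by have : K (x, y, z) by []; rewrite K0.
have fc : continuous (fun p : Z * Z * Z => rho0 p.1.1 p.1.2).
  by move=> p; apply: cvg_separating; [exact: s|exact: c11|exact: c12].
have [p pK pmin] := compact_EVT_min K0 Kc (continuous_subspaceT fc).
exists (rho0 p.1.1 p.1.2).
  apply: (separating_gt0 s); apply/eqP => E.
  by move: pK; rewrite inE /K /h /= E subrr normr0 leNgt e0.
move=> x y xy z; rewrite ltNge; apply/negP => ez.
have := pmin (x, y, z); rewrite inE => /(_ ez) /=.
by rewrite leNgt xy.
Qed.

End Modulus.

(** * Metrics with a prescribed peak *)

Section Admissible.
Variables (R : realType) (Z : Type) (rho : Z -> Z -> R).

Definition admissible (u : Z -> R) : Prop :=
  (forall x, 0 < u x) /\ (forall x y, rho x y <= u x * u y).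

(** In multiplicative form, these are the extremal functions of the injective
    hull: [u x] is the least positive number above all [rho x y / u y]. The
    condition below states this without mentioning a supremum. *)
Definition extremal (u : Z -> R) : Prop :=
  admissible u /\
  forall x (c : R), 0 < c -> c < u x -> exists y, c * u y < rho x y.

End Admissible.

(** A minimal admissible function below [k] is extremal, since an admissible
    function stays admissible when its value at [x] is lowered to a positive
    bound of all [rho x y / u y]; the condition at [(x, x)] survives because
    [rho x x = 0]. Minimal functions exist by Zorn's lemma: pointwise infima of
    chains are admissible, and positive because every [x] has some [y] with
    [0 < rho x y]. *)
Lemma extremal_below (R : realType) (Z : choiceType) (rho : Z -> Z -> R) k :
  (forall x, rho x x = 0) -> (forall x y, rho x y = rho y x) ->
  (forall x, exists y, 0 < rho x y) -> admissible rho k ->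
  exists2 u, extremal rho u & forall x, u x <= k x.
Proof.
move=> rxx rC rpos kA.
pose T := {u : Z -> R | admissible rho u /\ forall x, u x <= k x}.
pose le (u v : T) := `[< forall x, sval v x <= sval u x >].
pose k' : T := exist _ k (conj kA (fun=> lexx _)).
have [|||[u [uA uk]] umin] := @ZL_preorder T k' le.
- by move=> u; apply/asboolP.
- move=> u v w /asboolP uv /asboolP vw; apply/asboolP => x.
  exact: le_trans (uv x).
- move=> A Atot.
  have [[u0 Au0]|A0] := pselect (A !=set0); last first.
    by exists k' => s As; case: A0; exists s.
  pose S x := [set sval u x | u in A].
  have S0 x : S x !=set0 by exists (sval u0 x), u0.
  have Slb x : has_lbound (S x).
    by exists 0 => _ [u _ <-]; apply/ltW; have [[]] := svalP u.
  have prod u v x y : A u -> A v -> rho x y <= sval u x * sval v y.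
    move=> Au Av; have [[up ur] _] := svalP u; have [[vp vr] _] := svalP v.
    have [/asboolP uv|/asboolP vu] := Atot _ _ Au Av.
      by apply: le_trans (vr x y) _; rewrite ler_wpM2r// ltW.
    by apply: le_trans (ur x y) _; rewrite ler_wpM2l// ltW.
  pose v x := inf (S x).
  have lev u x : A u -> v x <= sval u x.
    by move=> Au; apply: ge_inf => //; exists u.
  have v0 x : 0 < v x.
    have [y xy] := rpos x; have [[up ur] _] := svalP u0.
    apply: lt_le_trans (divr_gt0 xy (up y)) _.
    apply: lb_le_inf => // _ [u Au <-].
    by rewrite ler_pdivrMr//; exact: prod.
  have vP : admissible rho v /\ forall x, v x <= k x.
    split; last first.
      by move=> x; apply: le_trans (lev u0 x Au0) _; have [] := svalP u0.
    split=> // x y; rewrite -ler_pdivrMl//.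
    apply: lb_le_inf => // _ [w Aw <-]; have [[wp _] _] := svalP w.
    rewrite ler_pdivrMl// -ler_pdivrMr//.
    apply: lb_le_inf => // _ [w' Aw' <-]; rewrite ler_pdivrMr//.
    exact: prod.
  exists (exist _ v vP) => s As; apply/asboolP => x; exact: lev.
exists u => //; split => // x c c0 cu; apply: contrapT => H.
have {}H y : rho x y <= c * u y.
  by rewrite leNgt; apply/negP => ?; apply: H; exists y.
pose v y := if y == x then c else u y.
have [up ur] := uA.
have vA : admissible rho v.
  split=> [y|y z]; rewrite /v; first by case: ifP.
  have [->|yx] := eqVneq y x; have [->|zx] := eqVneq z x => //.
  - by rewrite rxx mulr_ge0 ?ltW.
  - by rewrite rC mulrC.
have vu y : v y <= u y by rewrite /v; case: eqP => [->|//]; exact: ltW.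
have vk y : v y <= k y by apply: le_trans (vu y) (uk y).
have := umin (exist _ v (conj vA vk)); rewrite /le /=.
move=> /(_ (introT (asboolP _) vu))/asboolP /(_ x).
by rewrite /v eqxx leNgt cu.
Qed.

Section Ray.
Variables (R : realType) (Z : topologicalType) (rho0 : Z -> Z -> R).
Hypothesis rho0P : antipodal_space rho0.
Local Notation M := (moebius_space rho0).
Let c0 := antipodal_semimetric rho0P.
Let s0 := semimetric_separating c0.

Lemma near_uniformly_close (e : R) x : 0 < e ->
  \forall t \near x, forall z, `|rho0 x z - rho0 t z| < e.
Proof.
move=> e0; have [dl dl0 H] := semimetric_modulus c0 e0.
have := @separating_continuousl _ _ rho0 x s0 x.
rewrite /continuous_at separating_diag// => /cvgr_lt /(_ _ dl0).
by apply: filterS => t /= xt; apply: H; rewrite (separating_sym s0).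
Qed.

Section Extremal.
Variable u : Z -> R.
Hypothesis uE : extremal rho0 u.
Let u0 x : 0 < u x. Proof. by case: uE => -[]. Qed.
Let ur x y : rho0 x y <= u x * u y. Proof. by case: uE => -[]. Qed.

(** [u x] is the supremum of [rho0 x y / u y] over [y], where the denominators
    are bounded below by [a] and the numerators move by less than [e]. *)
Lemma extremal_lipschitz (a e : R) x t :
  0 < a -> 0 < e -> (forall y, a <= u y) ->
  (forall z, `|rho0 x z - rho0 t z| < e) -> u x <= u t + e / a.
Proof.
move=> a0 e0 au H; rewrite leNgt; apply/negP => ult.
have ea : 0 < e / a by rewrite divr_gt0.
have [||y] := uE.2 x (u t + e / a); [by rewrite addr_gt0|by []|].
have := H y; rewrite ltr_distlC => /andP[h _].
have := ur t y; have : e <= e / a * u y.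
  by rewrite mulrAC ler_pdivlMr// ler_pM2l.
rewrite mulrDl; lra.
Qed.

Lemma extremal_continuous (a : R) :
  0 < a -> (forall y, a <= u y) -> continuous u.
Proof.
move=> a0 au x; apply/cvgrPdist_le => e e0.
have ea0 : 0 < e * a by rewrite mulr_gt0.
have := near_uniformly_close x ea0; apply: filterS => t H.
rewrite ler_distl; apply/andP; split.
  have := extremal_lipschitz a0 ea0 au (x:=t) (t:=x).
  rewrite mulfK ?gt_eqF// lerBlDr; apply=> z; rewrite distrC; exact: H.
by have := extremal_lipschitz a0 ea0 au H; rewrite mulfK ?gt_eqF.
Qed.

Lemma extremal_attained x : continuous u -> exists y, rho0 x y = u x * u y.
Proof.
move=> uc.
have fc : continuous (fun y => rho0 y x / u y).
  move=> y; apply: cvgM; first exact: separating_continuousl.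
  by apply: cvgV; [rewrite gt_eqF|exact: uc].
have [y _ ymax] := compact_EVT_max (ex_intro _ x I : [set: Z] !=set0)
  (semimetric_compact c0) (continuous_subspaceT fc).
exists y; apply/eqP; rewrite eq_le ur/=.
rewrite leNgt; apply/negP => lt.
have {}lt : rho0 y x / u y < u x.
  by rewrite ltr_pdivrMr// (separating_sym s0).
(* The term [u x / 2] ensures that [c] is positive. *)
pose c := Num.max (rho0 y x / u y) (u x / 2).
have [||z] := uE.2 x c.
- by rewrite lt_max (divr_gt0 (u0 x))// orbT.
- by rewrite gt_max lt; have := u0 x; lra.
rewrite ltNge -ler_pdivrMr// => /negP; apply.
rewrite le_max (separating_sym s0).
by rewrite ymax ?inE.
Qed.

End Extremal.

(** Extremality makes [rho] antipodal: it gives each point a partner at which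
    [rho0 x y / (u x * u y)] equals [1], while admissibility bounds it by
    [1]. *)
Lemma moebius_space_extremal u (a : R) :
  0 < a -> (forall y, a <= u y) -> extremal rho0 u ->
  let rho := (fun x y => rho0 x y / (u x * u y)) in
  M rho /\ forall x, potential rho0 rho x = - ln (u x).
Proof.
move=> a0 au uE; have uc := extremal_continuous uE a0 au.
have [[u0 ur] _] := uE.
have uatt x := extremal_attained uE x uc.
have un x : u x != 0 by rewrite gt_eqF.
move=> rho.
have rle x y : rho x y <= 1 by rewrite ler_pdivrMr ?mulr_gt0// mul1r.
have ratt x : exists y, rho x y = 1.
  by have [y E] := uatt x; exists y; rewrite /rho E divff// mulf_neq0.
have rP : antipodal_space rho.
  split=> //.
  - split; [exact: semimetric_compact c0|exact: semimetric_metrizable c0|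
      exact: semimetric_four_points c0|].
    split.
    + move=> [x y]; apply: cvgM.
        exact: (@separating_continuous _ _ _ s0 (x, y)).
      apply: cvgV; first by rewrite mulf_neq0.
      apply: cvgM.
        by apply: (@cvg_comp _ _ _ fst u _ (nbhs x)); [exact: cvg_fst|exact: uc].
      by apply: (@cvg_comp _ _ _ snd u _ (nbhs y)); [exact: cvg_snd|exact: uc].
    + by move=> x y; rewrite /rho (separating_sym s0) [u x * _]mulrC.
    + by move=> x y; rewrite /rho divr_ge0 ?(separating_ge0 s0)// ltW// mulr_gt0.
    + move=> x y; rewrite -(separating_eq0 s0); split; last first.
        by rewrite /rho => ->; rewrite mul0r.
      move/eqP; rewrite mulf_eq0 invr_eq0 mulf_eq0 !(negbTE (un _)) !orbF.
      by move/eqP.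
  - apply/eqP; rewrite eq_le; apply/andP; split.
      by apply: ge_ereal_sup => _ [[x y] _ <-]; rewrite lee_fin.
    have [x _] := semimetric_four_points c0; have [y <-] := ratt x.
    by apply: ereal_sup_ubound; exists (x, y).
have rM : M rho.
  split=> // x x' y y'; rewrite /= !inE !negb_or -!andbA.
  case/and5P => _ xy xy' x'y /andP[x'y' _].
  have := un x; have := un x'; have := un y; have := un y'.
  move: (separating_gt0 s0 xy) (separating_gt0 s0 xy').
  move: (separating_gt0 s0 x'y) (separating_gt0 s0 x'y').
  do 4!move=> /lt0r_neq0 ?; move=> *; rewrite /cross_ratio /rho.
  by field; do ?[apply/andP; split].
split=> // x; rewrite /potential.
rewrite (@moebius_derivativeE _ _ _ _ (fun x => u x ^- 2))//.
  by rewrite lnV ?posrE ?exprn_gt0// lnXn//; lra.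
split.
- move=> y; apply: cvgV; first by rewrite expf_neq0.
  by under eq_fun do rewrite expr2; rewrite expr2; apply: cvgM; exact: uc.
- by move=> y; rewrite invr_gt0 exprn_gt0.
- by move=> y z; rewrite /rho; field; rewrite !un.
Qed.

(** Start from the admissible function equal to [exp (- t / 2)] at [x] and to
    [exp (t / 2)] elsewhere, and take an extremal function [u] below it. By
    antipodality of [rho0], an admissible function bounded by [exp (t / 2)] is
    at least [exp (- t / 2)]; hence the potential [- ln u] has norm [t / 2],
    attained at [x]. *)
Lemma moebius_space_ray (t : R) x : 0 <= t -> exists rho,
  [/\ M rho, moebius_dist rho0 rho = t & 2 * potential rho0 rho x = t].
Proof.
move=> t0.
pose a := expR (t / 2).
have a0 : 0 < a by exact: expR_gt0.
have a1 : 1 <= a by rewrite -expR0 ler_expR; lra.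
have ai0 : 0 < a^-1 by rewrite invr_gt0.
have ai : a^-1 <= a by apply: (@le_trans _ _ 1) => //; rewrite invf_le1.
pose k y := if y == x then a^-1 else a.
have [||||u uE uk] := @extremal_below _ _ rho0 k.
- by move=> y; exact: separating_diag.
- exact: separating_sym.
- by move=> y; have [z yz] := antipodal_ex rho0P y; exists z; rewrite yz.
- split=> [y|y z]; rewrite /k; first by case: ifP; rewrite ?invr_gt0.
  have [->|yx] := eqVneq y x; have [->|zx] := eqVneq z x.
  + by rewrite separating_diag// mulr_ge0 ?invr_ge0 ?ltW.
  + by rewrite mulVf ?gt_eqF// antipodal_le1.
  + by rewrite mulfV ?gt_eqF// antipodal_le1.
  + apply: le_trans (antipodal_le1 _ _ rho0P) _.
    by rewrite -[leLHS]mulr1 ler_pM.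
have [[u0 ur] _] := uE.
have ua y : u y <= a.
  by apply: le_trans (uk y) _; rewrite /k; case: ifP.
have au y : a^-1 <= u y.
  have [z yz] := antipodal_ex rho0P y; have := ur y z; rewrite yz.
  rewrite -ler_pdivrMr ?mul1r// => /(le_trans _); apply.
  by rewrite lef_pV2 ?posrE.
have ux : u x = a^-1.
  by apply/eqP; rewrite eq_le au andbT; have := uk x; rewrite /k eqxx.
have [rM rE] := moebius_space_extremal ai0 au uE.
have lna : ln a = t / 2 by rewrite /a expRK.
have psix : 2 * potential rho0 (fun x y => rho0 x y / (u x * u y)) x = t.
  by rewrite rE ux lnV// opprK lna; lra.
exists (fun x y => rho0 x y / (u x * u y)); split => //.
apply/eqP; rewrite eq_le; apply/andP; split; last first.
  have := moebius_dist_base rho0P x rM.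
  by apply: le_trans; rewrite -{1}psix ler_pM2l// ler_norm.
have [y] := moebius_dist_attained rho0P (moebius_space_base rho0P) rM.
rewrite potential_base// subr0 rE normrN => -> _.
have l1 : ln (u y) <= t / 2 by rewrite -lna ler_ln ?posrE.
have l2 : - (t / 2) <= ln (u y) by rewrite -lna -lnV// ler_ln ?posrE.
have : `|ln (u y)| <= t / 2 by rewrite ler_norml l1 l2.
lra.
Qed.

End Ray.

(** * The correspondence between the two spaces *)

Lemma expRN_lipschitz (R : realType) (a b : R) : 0 <= a -> 0 <= b ->
  `|expR (- a) - expR (- b)| <= `|a - b|.
Proof.
wlog ab : a b / a <= b.
  move=> H a0 b0; have [ab|/ltW ba] := leP a b; first exact: H.
  by rewrite distrC [leRHS]distrC; exact: H.
move=> a0 b0; rewrite distrC [leRHS]distrC.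
rewrite ler0_norm ?subr_le0 ?ler_expR ?lerN2//.
rewrite ger0_norm ?subr_ge0// opprB.
have -> : expR (- b) = expR (- a) * expR (- (b - a)).
  by rewrite -expRD; congr expR; ring.
have E : expR (- a) <= 1 by rewrite expR_le1 oppr_le0.
rewrite -{1}[expR (- a)]mulr1 -mulrBr.
have h := expR_ge1Dx (- (b - a)).
apply: (@le_trans _ _ (expR (- a) * (b - a))).
  by rewrite ler_wpM2l ?expR_ge0//; lra.
by rewrite ler_piMl// subr_ge0.
Qed.

Lemma modulus_le (R : realType) (Z : Type) (rho : Z -> Z -> R) (e dl dl' : R) :
  dl' <= dl -> modulus rho e dl -> modulus rho e dl'.
Proof. by move=> le m x y xy; apply: m; exact: lt_le_trans le. Qed.

Section Correspondence.
Variables (R : realType) (Y Z : topologicalType).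
Variables (sigma : Y -> Y -> R) (rho : Z -> Z -> R).
Hypotheses (sigmaP : antipodal_space sigma) (rhoP : antipodal_space rho).
Variables (t eta : R) (F : (Y -> Y -> R) -> (Z -> Z -> R)).
Hypotheses (t0 : 0 <= t) (eta0 : 0 < eta) (eta1 : 2 * eta <= 1).
Local Notation r := (t + 1).
Local Notation dY := (@moebius_dist R Y).
Local Notation dZ := (@moebius_dist R Z).
Local Notation BY := (metric_cball (moebius_space sigma) dY sigma r).
Local Notation BZ := (metric_cball (moebius_space rho) dZ rho r).
Hypothesis FP : metric_isometry BY dY BZ dZ eta F.
Hypothesis Fbase : F sigma = rho.

(** The point [y] of [Y] and the point [z] of [Z] are seen in almost the same
    direction: they are peaks of far away metrics [p] and [q] that [F] almost
    matches. The metric [q] need not be the image of [p], so that the relation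
    can be total on the side of [Z] as well. *)
Definition peak_correspondence (y : Y) (z : Z) : Prop :=
  exists p q, [/\ BY p /\ t <= dY sigma p, BZ q /\ t <= dZ rho q,
    2 * potential sigma p y = dY sigma p, 2 * potential rho q z = dZ rho q &
    dZ (F p) q <= eta].

Let FB p : BY p -> BZ (F p). Proof. by case: FP => + _ _; exact. Qed.

Let Fdist p p' : BY p -> BY p' -> `|dZ (F p) (F p') - dY p p'| < eta.
Proof.
move=> Bp Bp'; case: FP => _ + _; rewrite -lte_fin; apply: le_lt_trans.
by apply: ereal_sup_ubound; exists (p, p').
Qed.

Let Bsigma : BY sigma.
Proof.
by split; [exact: moebius_space_base|rewrite moebius_distxx// addr_ge0].
Qed.

Let Fdist_base p : BY p -> `|dZ rho (F p) - dY sigma p| < eta.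
Proof. by move=> Bp; rewrite -{1}Fbase; exact: Fdist. Qed.

Lemma peak_correspondence_left y : exists z, peak_correspondence y z.
Proof.
have r0 : 0 <= r by rewrite addr_ge0.
have [p [Mp dp py]] := moebius_space_ray sigmaP y r0.
have Bp : BY p by split=> //; rewrite dp.
have [MFp _] := FB Bp.
have [z pz] := potential_peak rhoP MFp.
exists z, p, (F p); split => //.
- by rewrite dp; split=> //; lra.
- split; first exact: FB.
  have := Fdist_base Bp; rewrite dp ltr_distlC => /andP[].
  by have := eta1; lra.
- by rewrite dp.
- have [w -> _] := moebius_dist_attained rhoP MFp MFp.
  by rewrite subrr normr0 mulr0 ltW.
Qed.

Lemma peak_correspondence_right z : exists y, peak_correspondence y z.
Proof.
have r0 : 0 <= r by rewrite addr_ge0.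
have [q [Mq dq qz]] := moebius_space_ray rhoP z r0.
have Bq : BZ q by split=> //; rewrite dq.
have [p Bp [_ pq]] : (\bigcup_(x in BY) metric_cball BZ dZ (F x) eta) q.
  by case: FP => _ _ <-.
have [y py] := potential_peak sigmaP Bp.1.
exists y, p, q; split => //.
- split=> //.
  have := moebius_dist_triangle rhoP (moebius_space_base rhoP) (FB Bp).1 Mq.
  have := Fdist_base Bp; rewrite dq ltr_distlC => /andP[].
  by have := eta1; lra.
- by rewrite dq; split=> //; lra.
- by rewrite dq.
Qed.

Variables (e dl : R).
Hypotheses (e0 : 0 < e) (dl0 : 0 < dl) (te : expR (- t) < e * dl).
Hypotheses (sigma_mod : modulus sigma e dl) (rho_mod : modulus rho e dl).

(** The Gromov products of [p], [p'] and of [q], [q'] differ by at most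
    [4 * eta], and their exponentials agree with [sigma] and [rho] up to
    [2 * e] on one side only. *)
Lemma peak_correspondence_distortion y y' z z' :
  peak_correspondence y z -> peak_correspondence y' z' ->
  `|sigma y y' - rho z z'| <= 2 * e + 4 * eta.
Proof.
move=> [p [q [[Bp tp] [Bq tq] py qz pq]]].
move=> [p' [q' [[Bp' tp'] [Bq' tq'] py' qz' pq']]].
have := gromov_product_estimate sigmaP e0 dl0 sigma_mod te Bp.1 Bp'.1
  tp tp' py py'.
have := gromov_product_estimate rhoP e0 dl0 rho_mod te Bq.1 Bq'.1
  tq tq' qz qz'.
have := expRN_lipschitz (gromov_product_ge0 sigmaP Bp.1 Bp'.1)
  (gromov_product_ge0 rhoP Bq.1 Bq'.1).
have : `|gromov_product sigma p p' - gromov_product rho q q'| <= 4 * eta.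
  have h1 := Fdist Bp Bp'; have h2 := Fdist_base Bp; have h3 := Fdist_base Bp'.
  have Mr := moebius_space_base rhoP.
  have [Mp _] := FB Bp; have [Mp' _] := FB Bp'.
  have [Mq _] := Bq; have [Mq' _] := Bq'.
  have tri := @moebius_dist_triangle _ _ _ rhoP.
  have a1 := tri _ _ _ Mr Mp Mq; have a2 := tri _ _ _ Mr Mq Mp.
  have a3 := tri _ _ _ Mr Mp' Mq'; have a4 := tri _ _ _ Mr Mq' Mp'.
  have a5 := tri _ _ _ Mp Mq Mp'; have a6 := tri _ _ _ Mq Mq' Mp'.
  have a7 := tri _ _ _ Mq Mp Mq'; have a8 := tri _ _ _ Mp Mp' Mq'.
  have E1 := moebius_distC rhoP Mp Mq; have E2 := moebius_distC rhoP Mp' Mq'.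
  rewrite -E1 in a2 a7; rewrite -E2 in a4 a6.
  move: h1 h2 h3; rewrite !ltr_distl => /andP[b1 b2] /andP[b3 b4] /andP[b5 b6].
  rewrite /gromov_product.
  move: a1 a2 a3 a4 a5 a6 a7 a8 b1 b2 b3 b4 b5 b6 pq pq' (eta0).
  move: (dZ _ _) (dZ _ _) (dZ _ _) (dZ _ _) (dZ _ _) (dZ _ _) => *.
  rewrite ler_norml; apply/andP; split; lra.
move: (gromov_product _ _ _) (gromov_product _ _ _) => g g'.
move=> h1 /le_trans /(_ h1); rewrite !ler_norml.
move=> /andP[h2 h3] /andP[h4 h5] /andP[h6 h7].
have e0' := e0; apply/andP; split; lra.
Qed.

End Correspondence.

Lemma correspondence_isometry (R : realType) (Y Z : Type) (sigma : Y -> Y -> R)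
    (rho : Z -> Z -> R) (C : Y -> Z -> Prop) (s e : R) :
  (forall y, sigma y y = 0) -> s < e ->
  (forall y, exists z, C y z) -> (forall z, exists y, C y z) ->
  (forall y y' z z', C y z -> C y' z' -> `|sigma y y' - rho z z'| <= s) ->
  exists f, semimetric_isometry sigma rho e f.
Proof.
move=> syy se Cl Cr Cd; have [f fC] := choice Cl.
exists f; split.
  apply: (@le_lt_trans _ _ s%:E); last by rewrite lte_fin.
  apply: ge_ereal_sup => _ [[y y'] _ <-]; rewrite lee_fin distrC.
  by apply: Cd; exact: fC.
move=> z; have [y yz] := Cr z; exists y.
have := Cd _ _ _ _ (fC y) yz; rewrite syy sub0r normrN => h.
apply: le_lt_trans se; exact: le_trans (ler_norm _) h.
Qed.

Theorem corollary1p5 (R : realType)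
    (Zn : nat -> topologicalType) (rhon : forall n : nat, Zn n -> Zn n -> R)
    (Z : topologicalType) (rho0 : Z -> Z -> R)
    (hequi : equicontinuous_spaces rhon)
    (hn : forall n : nat, antipodal_space (rhon n))
    (h0 : antipodal_space rho0)
    (hGH : pointed_GH_converges
             (fun n : nat => moebius_space (rhon n))
             (fun n : nat => @moebius_dist R (Zn n)) rhon
             (moebius_space rho0) (@moebius_dist R Z) rho0) :
  AI_converges rhon rho0.
Proof.
have AI_ge0 n : (0 <= AI_dist (rhon n) rho0)%E.
  by apply: le_ereal_inf_tmp => _ [e [e0 _ _] <-]; rewrite lee_fin ltW.
suff AI_le (e : R) : 0 < e ->
    \forall n \near \oo, (AI_dist (rhon n) rho0 <= e%:E)%E.
  apply/fine_cvgP; split.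
    have := AI_le 1 ltr01; apply: filterS => n h.
    by rewrite ge0_fin_numE//; exact: le_lt_trans h (ltry _).
  apply/cvgrPdist_le => e e0; have := AI_le e e0; apply: filterS => n h.
  rewrite sub0r normrN /= ger0_norm ?fine_ge0//.
  rewrite -lee_fin fineK// ge0_fin_numE//; exact: le_lt_trans h (ltry _).
move=> eps0.
(* The distortion below is at most [2 * s + 4 * eta <= e / 2]. *)
pose s : R := e / 12.
have s0 : 0 < s by rewrite divr_gt0.
have [dl1 dl10 m1] := semimetric_modulus (antipodal_semimetric h0) s0.
have [dl2 dl20 m2] := hequi _ s0.
pose dl := Num.min dl1 dl2.
have dl0 : 0 < dl by rewrite lt_min dl10.
have m1' : modulus rho0 s dl by apply: modulus_le m1; rewrite ge_min lexx.
have m2' n : modulus (rhon n) s dl.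
  move=> x y xy z; have /m2 : rhon n x y < dl2.
    by apply: lt_le_trans xy _; rewrite ge_min lexx orbT.
  rewrite -lte_fin; apply: le_lt_trans.
  by apply: ereal_sup_ubound; exists z.
(* The radius is [t + 1]: the unit absorbs the error [2 * eta] made when
   metrics at distance [t + 1] are moved by [F]. *)
pose t : R := `|ln (s * dl)| + 1.
have t0 : 0 <= t by rewrite addr_ge0.
have te : expR (- t) < s * dl.
  rewrite -[ltRHS]lnK ?posrE ?mulr_gt0// ltr_expR /t.
  have := ler_norm (- ln (s * dl)); rewrite normrN; lra.
pose eta := Num.min s (1 / 2).
have eta0 : 0 < eta by rewrite lt_min s0 divr_gt0.
have etas : eta <= s by rewrite ge_min lexx.
have eta1 : 2 * eta <= 1.
  have : eta <= 1 / 2 by rewrite ge_min lexx orbT.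
  lra.
have r0 : 0 < t + 1 by lra.
have [n0 H] := hGH _ _ r0 eta0.
exists n0 => // n /H [F [FP Fb]].
apply: ereal_inf_lbound; exists e => //.
have Cl := peak_correspondence_left (hn n) h0 t0 eta0 eta1 FP Fb.
have Cr := peak_correspondence_right (hn n) h0 t0 eta1 FP Fb.
have Cd := @peak_correspondence_distortion _ _ _ _ _ (hn n) h0 _ _ _
  t0 eta0 FP Fb _ _ s0 dl0 te (m2' n) m1'.
have lt : 2 * s + 4 * eta < e by rewrite /s in etas *; lra.
have diag := separating_diag.
split=> //.
  apply: (correspondence_isometry _ lt Cl Cr) => // y.
  by apply: diag; exact: semimetric_separating (antipodal_semimetric (hn n)).
apply: (correspondence_isometry
   (C := fun z y => peak_correspondence (rhon n) rho0 t eta F y z)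
   _ lt Cr Cl) => [z|].
  by apply: diag; exact: semimetric_separating (antipodal_semimetric h0).
by move=> z z' y y' yz yz'; rewrite distrC; exact: Cd.
Qed.
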